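(* Let $a,b,c,d$ be fixed elements of a commutative polynomial ring $R$ and let $f:\mathbb{Z}_{\geq 0}\to R$. Consider assigning to each finite graph $G$ a value $F(G)\in R$ by the rules (1) $F(G)=aF(G-e)+bF(G/e)+cF(G-u)+cF(G-v)+dF(G-u-v)$ for an edge $e$ of $G$ with distinct endpoints $u\neq v$; (2) $F(G_1+G_2)=F(G_1)F(G_2)$ for disjoint unions of nonempty graphs; (3) $F(K_1^n)=f(n)$ for $n\geq 0$, and $F(\phi)=1$. Then $F$ is well-defined (i.e. the value obtained by applying these rules recursively does not depend on the choice of edges and the order in which the rules are applied, so that $F$ is a graph invariant satisfying (1)--(3)) if and only if $bc+c^2+d-ad=0$ or $F$ is trivial, i.e. $F(G)=F(K_1)^{\#V(G)}$ for every nonempty graph $G$.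
   Context: Graphs are finite triples $G=(V,E,\varphi)$ with loops and multiple edges allowed, $\varphi$ mapping each edge to an unordered pair of (possibly equal) vertices; $\phi$ is the empty graph. $G_1+G_2$ is the disjoint union. $K_1^n$ is the graph with one vertex and $n$ loops; $K_1=K_1^0$. For an edge $e$ with endpoints $u\neq v$: $G-e$ deletes $e$; $G/e$ deletes $e$ and identifies $u$ and $v$ (other edges between $u$ and $v$ become loops); $G-u$ deletes $u$ and its incident edges; $G-u-v$ deletes $u$, $v$ and their incident edges.
   Formalization: The ring R is taken to be an integral domain (e.g. a polynomial ring over a domain); with zero divisors the claim fails, e.g. over (Z/4)[x] with a=b=c=0, d=2, f=0, where F is well-defined and nontrivial but bc+c²+d−ad=2≠0. *)

(* Defs.v *)
From HB Require Import structures.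
From mathcomp Require Import all_boot all_order all_algebra.

Set Implicit Arguments.
Unset Strict Implicit.
Unset Printing Implicit Defensive.

Import GRing.Theory.
Local Open Scope ring_scope.

(* An unordered pair of possibly equal vertices is a set of the form
   [set x; y]; it is a singleton exactly when the edge is a loop. *)
Definition is_upair (T : finType) (A : {set T}) : bool :=
  [exists x, exists y, A == [set x; y]].

Record mgraph := MGraph {
  vert : finType;
  edge : finType;
  ends : edge -> {set vert};
  endsP : forall e, is_upair (ends e)
}.

Arguments ends : clear implicits.

Lemma is_upair_imset (T U : finType) (h : T -> U) (A : {set T}) :
  is_upair A -> is_upair (h @: A).
Proof.
case/existsP=> x /existsP[y /eqP->]; apply/existsP; exists (h x).
by apply/existsP; exists (h y); rewrite imsetU !imset_set1.
Qed.

Lemma is_upair_preimset (T : finType) (P : pred T) (A : {set T}) :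
  is_upair A -> (forall x, x \in A -> P x) ->
  is_upair [set z : {x : T | P x} | val z \in A].
Proof.
case/existsP=> x /existsP[y /eqP->] PA.
have Px : P x by apply: PA; rewrite set21.
have Py : P y by apply: PA; rewrite set22.
apply/existsP; exists (exist _ x Px); apply/existsP; exists (exist _ y Py).
by apply/eqP/setP=> z; rewrite !inE -!val_eqE.
Qed.

Definition nonempty (G : mgraph) : Prop := (0 < #|vert G|)%N.

Definition miso (G H : mgraph) : Prop :=
  exists (hv : vert G -> vert H) (he : edge G -> edge H),
    [/\ bijective hv, bijective he
      & forall e, ends H (he e) = hv @: ends G e].

Definition empty_graph : mgraph :=
  @MGraph void void (fun e => match e with end) (fun e => match e with end).

Lemma loops_subproof (n : nat) (e : 'I_n) : is_upair [set tt].
Proof. by apply/existsP; exists tt; apply/existsP; exists tt; rewrite setUid. Qed.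

Definition K1 (n : nat) : mgraph :=
  @MGraph unit 'I_n (fun=> [set tt]) (@loops_subproof n).

Definition union_ends (G1 G2 : mgraph) (e : edge G1 + edge G2) :
    {set vert G1 + vert G2} :=
  match e with
  | inl e1 => inl @: ends G1 e1
  | inr e2 => inr @: ends G2 e2
  end.

Lemma union_subproof (G1 G2 : mgraph) (e : edge G1 + edge G2) :
  is_upair (union_ends e).
Proof. by case: e => e /=; apply/is_upair_imset/endsP. Qed.

Definition munion (G1 G2 : mgraph) : mgraph :=
  @MGraph (vert G1 + vert G2)%type (edge G1 + edge G2)%type
    (@union_ends G1 G2) (@union_subproof G1 G2).

Definition del_edge (G : mgraph) (e : edge G) : mgraph :=
  @MGraph (vert G) {x : edge G | x != e}
    (fun x => ends G (val x)) (fun x => endsP (val x)).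

Lemma del_verts_subproof (G : mgraph) (A : {set vert G})
    (e : {x : edge G | [disjoint ends G x & A]}) :
  is_upair [set z : {x : vert G | x \notin A} | val z \in ends G (val e)].
Proof.
apply: is_upair_preimset; first exact: endsP.
by move=> x xe; rewrite (disjointFr (valP e) xe).
Qed.

Definition del_verts (G : mgraph) (A : {set vert G}) : mgraph :=
  @MGraph {x : vert G | x \notin A} {x : edge G | [disjoint ends G x & A]}
    (fun e => [set z | val z \in ends G (val e)]) (@del_verts_subproof G A).

(* [None] is the vertex obtained by merging the endpoints of [e]: [insub]
   sends every endpoint of [e] to [None] and every other vertex [x] to
   [Some x].  Edges parallel to [e] thus get the end set [set None], i.e.
   become loops. *)
Definition contract_vert (G : mgraph) (e : edge G) (x : vert G) :
    option {x : vert G | x \notin ends G e} := insub x.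

Definition contract (G : mgraph) (e : edge G) : mgraph :=
  @MGraph (option {x : vert G | x \notin ends G e}) {x : edge G | x != e}
    (fun x => contract_vert e @: ends G (val x))
    (fun x => is_upair_imset (contract_vert e) (endsP (val x))).

Section Recursion.
Variables (R : comNzRingType) (a b c d : R) (f : nat -> R).

(* [value G x]: some way of applying the rules recursively to [G] yields [x].
   Graphs are taken up to isomorphism; every subterm may be evaluated by
   independent choices of edges and of decompositions. *)
Inductive value : mgraph -> R -> Prop :=
| value_edge (G : mgraph) (e : edge G) (u v : vert G)
    (xdel xcon xu xv xuv : R) :
    u != v -> ends G e = [set u; v] ->
    value (del_edge e) xdel ->
    value (contract e) xcon ->
    value (del_verts [set u]) xu ->
    value (del_verts [set v]) xv ->
    value (del_verts [set u; v]) xuv ->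
    value G (a * xdel + b * xcon + c * xu + c * xv + d * xuv)
| value_union (G1 G2 : mgraph) (x1 x2 : R) :
    nonempty G1 -> nonempty G2 -> value G1 x1 -> value G2 x2 ->
    value (munion G1 G2) (x1 * x2)
| value_K1 (n : nat) : value (K1 n) (f n)
| value_empty : value empty_graph 1
| value_iso (G H : mgraph) (x : R) : miso G H -> value G x -> value H x.

Definition graph_invariant (F : mgraph -> R) : Prop :=
  forall G H : mgraph, miso G H -> F G = F H.

Definition rule_edge (F : mgraph -> R) : Prop :=
  forall (G : mgraph) (e : edge G) (u v : vert G),
    u != v -> ends G e = [set u; v] ->
    F G = a * F (del_edge e) + b * F (contract e)
          + c * F (del_verts [set u]) + c * F (del_verts [set v])
          + d * F (del_verts [set u; v]).

Definition rule_union (F : mgraph -> R) : Prop :=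
  forall G1 G2 : mgraph, nonempty G1 -> nonempty G2 ->
    F (munion G1 G2) = F G1 * F G2.

Definition rule_base (F : mgraph -> R) : Prop :=
  (forall n : nat, F (K1 n) = f n) /\ F empty_graph = 1.

Definition well_defined : Prop :=
  exists F : mgraph -> R,
    (forall (G : mgraph) (x : R), value G x <-> x = F G) /\
    [/\ graph_invariant F, rule_edge F, rule_union F & rule_base F].

(* Phrased on the possibly multivalued [value], so that it makes sense before
   well-definedness is known. *)
Definition trivial : Prop :=
  forall (G : mgraph) (x k : R), nonempty G ->
    value G x -> value (K1 0) k -> x = k ^+ #|vert G|.

End Recursion.

(* Main.v *)
Require Import Defs.
From HB Require Import structures.
From mathcomp Require Import all_boot all_order all_algebra.
From mathcomp Require Import zify ring.

(** Write [q = b c + c^2 + d - a d].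

    Sufficiency of [q = 0].  Fix the vertex set and process the edges one at a
    time.  The intermediate graph is recorded by a partial partition of the
    vertices into blocks (merged vertices), each with its number of loops, some
    vertices having been deleted; rule (1) for one edge is then a linear operator
    on functions of such states.  Two of these operators commute, except when
    their edges [uv], [vw] share exactly one block, where the commutator is [q]
    times the difference of the states with [u, v] and with [v, w] deleted.
    So for [q = 0] the outcome does not depend on the order of the edges, and it
    satisfies all the rules.

    Necessity.  Attach to a vertex [u] of [G] a pendant path [u - v - w].
    Expanding at [vw] or at [uv] first gives [q (F(G) - F(K_1) F(G - u)) = 0];
    if [q <> 0], removing the vertices one by one shows that [F] is trivial. *)

Set Implicit Arguments.
Unset Strict Implicit.
Unset Printing Implicit Defensive.

Import GRing.Theory.
Local Open Scope ring_scope.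

(** * Edge operators on block states *)

Section BlockStates.
Variable V : finType.

(* [s p = Some (B, n)]: [p] survives, its block is [B], which carries [n] loops. *)
Definition state := {ffun V -> option ({set V} * nat)}.
Implicit Types (s : state) (A B C : {set V}).

Definition upd B o s : state := [ffun p => if p \in B then o else s p].
Definition kill B s := upd B None s.
Definition put B n s := upd B (Some (B, n)) s.

(** Each block is stored once at every one of its vertices, so a state is meaningful only when these
    copies agree. Distinct blocks are then disjoint. *)
Definition wf s := forall p B n, s p = Some (B, n) ->
  p \in B /\ forall q, q \in B -> s q = Some (B, n).

Lemma updE B o s p : upd B o s p = if p \in B then o else s p.
Proof. by rewrite ffunE. Qed.

Lemma upd_swap B B' o o' s :
  [disjoint B & B'] -> upd B o (upd B' o' s) = upd B' o' (upd B o s).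
Proof.
move=> dis; apply/ffunP=> p; rewrite !ffunE.
by case: ifP => // pB; rewrite (disjointFr dis pB).
Qed.

Lemma disjointsU A B C :
  [disjoint A & C] -> [disjoint B & C] -> [disjoint A :|: B & C].
Proof. by rewrite -!setI_eq0 setIUl => /eqP-> /eqP->; rewrite setU0. Qed.

Lemma upd_absorb B B' o o' s : B' \subset B -> upd B o (upd B' o' s) = upd B o s.
Proof.
move=> /subsetP sub; apply/ffunP=> p; rewrite !ffunE.
by case: ifP => // pB; case: ifP => // /sub; rewrite pB.
Qed.

Lemma killU B B' s : kill B (kill B' s) = kill (B :|: B') s.
Proof. by apply/ffunP=> p; rewrite !ffunE inE; case: (p \in B). Qed.

Lemma wf_mem s x X m : wf s -> s x = Some (X, m) -> x \in X.
Proof. by move=> w /w[]. Qed.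

Lemma wf_other s x X m y Y n :
  wf s -> s x = Some (X, m) -> s y = Some (Y, n) -> X != Y -> x \in Y = false.
Proof.
move=> w sx sy; apply: contraNF => xY.
by have [_ /(_ _ xY)] := w _ _ _ sy; rewrite sx => -[->].
Qed.

Lemma wf_dead s x y Y n :
  wf s -> s x = None -> s y = Some (Y, n) -> x \in Y = false.
Proof.
move=> w sx sy; apply/negP => xY.
by have [_ /(_ _ xY)] := w _ _ _ sy; rewrite sx.
Qed.

Lemma wf_disjoint s x X m y Y n :
  wf s -> s x = Some (X, m) -> s y = Some (Y, n) -> X != Y -> [disjoint X & Y].
Proof.
move=> w sx sy nXY; rewrite -setI_eq0; apply/set0Pn => -[p /setIP[pX pY]].
have [_ /(_ _ pX) sp] := w _ _ _ sx; have [_ /(_ _ pY)] := w _ _ _ sy.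
by rewrite sp => -[e]; rewrite e eqxx in nXY.
Qed.

Lemma wf_eq s x X m y n :
  wf s -> s x = Some (X, m) -> s y = Some (X, n) -> m = n.
Proof. by move=> w sx sy; have [_ /(_ _ (wf_mem w sx))] := w _ _ _ sy; rewrite sx => -[]. Qed.

(** In a well-formed state, [B] is a union of surviving blocks. Overwriting such a set cuts no block
    in two, which keeps [kill] and [put] within well-formed states. *)
Definition saturated s B :=
  forall p, p \in B -> exists X m, s p = Some (X, m) /\ X \subset B.

Lemma wf_kill s B : wf s -> saturated s B -> wf (kill B s).
Proof.
move=> w sat p X m; rewrite updE; case: ifP => // pB sp.
split=> [|q qX]; first exact: wf_mem sp.
have [_ /(_ _ qX) sq] := w _ _ _ sp; rewrite updE; case: ifP => // qB.
have [X' [m' []]] := sat _ qB; rewrite sq => -[<- _] /subsetP/(_ _ (wf_mem w sp)).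
by rewrite pB.
Qed.

Lemma wf_put s B n : wf s -> saturated s B -> wf (put B n s).
Proof.
move=> w sat p X m; rewrite updE; case: ifP => [pB [<- <-]|pB sp].
  by split=> // q qB; rewrite updE qB.
have wk := wf_kill w sat; have := wk p X m; rewrite updE pB => /(_ sp)[pX h].
by split=> // q /h; rewrite !updE; case: ifP.
Qed.

Lemma saturated_block s x X m : wf s -> s x = Some (X, m) -> saturated s X.
Proof. by move=> w sx p pX; exists X, m; have [_ ->] := w _ _ _ sx. Qed.

Lemma saturatedU s B B' : saturated s B -> saturated s B' -> saturated s (B :|: B').
Proof.
move=> h h' p; rewrite inE => /orP[/h|/h'] [X [m [sp sub]]]; exists X, m; split=> //.
  by apply: subset_trans sub _; apply: subsetUl.
by apply: subset_trans sub _; apply: subsetUr.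
Qed.

Definition discrete : state := [ffun p => Some ([set p], 0%N)].

Lemma wf_discrete : wf discrete.
Proof.
move=> p B n; rewrite ffunE => -[<- <-]; split; first exact: set11.
by move=> q /set1P->; rewrite ffunE.
Qed.

Section Operators.
Variables (R : comNzRingType) (a b c d : R) (f : nat -> R).
Implicit Type Phi : state -> R.

(** [Phi] evaluates the state once this edge is processed. An edge with a deleted endpoint has
    disappeared, one inside a block has become a loop, and only one between two blocks is expanded
    by rule (1). *)
Definition step x y Phi s : R :=
  match s x, s y with
  | Some (X, m), Some (Y, n) =>
    if X == Y then Phi (put X m.+1 s)
    else a * Phi s + b * Phi (put (X :|: Y) (m + n) s) + c * Phi (kill X s)
         + c * Phi (kill Y s) + d * Phi (kill (X :|: Y) s)
  | _, _ => Phi s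
  end.

Lemma step_deadl x y Phi s : s x = None -> step x y Phi s = Phi s.
Proof. by rewrite /step => ->. Qed.

Lemma step_deadr x y Phi s : s y = None -> step x y Phi s = Phi s.
Proof. by rewrite /step => ->; case: (s x) => // -[]. Qed.

Lemma step_loop x y Phi s X m n :
  s x = Some (X, m) -> s y = Some (X, n) -> step x y Phi s = Phi (put X m.+1 s).
Proof. by rewrite /step => -> ->; rewrite eqxx. Qed.

Lemma step_edge x y Phi s X m Y n : X != Y ->
  s x = Some (X, m) -> s y = Some (Y, n) ->
  step x y Phi s =
    a * Phi s + b * Phi (put (X :|: Y) (m + n) s) + c * Phi (kill X s)
         + c * Phi (kill Y s) + d * Phi (kill (X :|: Y) s).
Proof. by rewrite /step => /negbTE nXY -> ->; rewrite nXY. Qed.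

Lemma stepC x y Phi s : wf s -> step x y Phi s = step y x Phi s.
Proof.
move=> w; case sx: (s x) => [[X m]|]; last by rewrite step_deadl // step_deadr.
case sy: (s y) => [[Y n]|]; last by rewrite step_deadr // step_deadl.
case: (eqVneq X Y) => [eXY|nXY].
  by rewrite -eXY in sy *; rewrite !(step_loop _ sx sy, step_loop _ sy sx) (wf_eq w sx sy).
rewrite (step_edge _ nXY sx sy) [X in _ = X](step_edge _ _ sy sx) 1?eq_sym //.
by rewrite setUC addnC; ring.
Qed.

Lemma eq_step x y Phi Phi' s :
  wf s -> (forall s', wf s' -> Phi s' = Phi' s') -> step x y Phi s = step x y Phi' s.
Proof.
move=> w e; rewrite /step; case sx: (s x) => [[X m]|]; last exact: e.
case sy: (s y) => [[Y n]|]; last exact: e.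
have hX := saturated_block w sx; have hY := saturated_block w sy.
have hXY := saturatedU hX hY.
by case: ifP => _; rewrite !e //; do ?[exact: wf_put | exact: wf_kill].
Qed.

(** * Commutation of the edge operators *)

Hypothesis q0 : b * c + c ^+ 2 + d - a * d = 0.

(** The operators never revive a deleted vertex, so the edge [zw] stays without effect in every
    state reached from [s]. *)
Lemma step_comm_dead x y z w Phi s : wf s -> s z = None \/ s w = None ->
  step x y (step z w Phi) s = step z w (step x y Phi) s.
Proof.
move=> ws dead.
have deadE Psi s' : (forall p, s p = None -> s' p = None) ->
    step z w Psi s' = Psi s'.
  by move=> h; case: dead => [/h|/h] ?; [apply: step_deadl | apply: step_deadr].
rewrite [RHS]deadE //.
case sx: (s x) => [[X m]|]; last by rewrite !(step_deadl y _ sx) deadE.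
case sy: (s y) => [[Y n]|]; last by rewrite !(step_deadr x _ sy) deadE.
have h o B : (B = X \/ B = Y \/ B = X :|: Y) -> forall p, s p = None -> upd B o s p = None.
  move=> eB p sp; rewrite updE; have pX := wf_dead ws sp sx; have pY := wf_dead ws sp sy.
  by case: eB => [->|[]->]; rewrite ?inE ?pX ?pY.
have [eXY|nXY] := eqVneq X Y.
  by rewrite -eXY in sy; rewrite !(step_loop _ sx sy) deadE //; apply: h; auto.
rewrite !(step_edge _ nXY sx sy).
by congr (_ * _ + _ * _ + _ * _ + _ * _ + _ * _); apply: deadE => //; apply: h; auto.
Qed.

(** A loop follows its block through each outcome of the other edge: it is kept, added to the count
    of a merged block, or deleted with its block. It may equally well be counted first. *)
Lemma step_comm_loop x y z w Phi s Z o : wf s ->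
  s z = Some (Z, o) -> s w = Some (Z, o) ->
  step x y (step z w Phi) s = step z w (step x y Phi) s.
Proof.
move=> ws sz sw.
case sx: (s x) => [[X m]|]; last by rewrite [RHS]step_comm_dead //; left.
case sy: (s y) => [[Y n]|]; last by rewrite [RHS]step_comm_dead //; right.
have zZ := wf_mem ws sz; have wZ := wf_mem ws sw.
have xX := wf_mem ws sx; have yY := wf_mem ws sy.
rewrite [RHS](step_loop _ sz sw).
have [eXY|nXY] := eqVneq X Y.
  rewrite -eXY in sy yY *; have en := wf_eq ws sx sy; rewrite -en in sy.
  rewrite (step_loop _ sx sy).
  have [eZ|nZ] := eqVneq X Z.
    rewrite eZ in sx sy xX yY *; have := wf_eq ws sx sz => em; rewrite em.
    by do 2![rewrite (@step_loop _ _ _ _ Z o.+1 o.+1) ?updE ?zZ ?wZ ?xX ?yY //].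
  have nZ' : Z != X by rewrite eq_sym.
  rewrite (@step_loop _ _ _ _ Z o o) ?updE ?(wf_other ws sz sx) ?(wf_other ws sw sx) //.
  rewrite (@step_loop _ _ _ _ X m m) ?updE ?(wf_other ws sx sz) ?(wf_other ws sy sz) //.
  by rewrite /put upd_swap // (wf_disjoint ws sz sx).
(* Here [Z] may be the first block but not the second; the case where it is the second reduces to
   this one by exchanging the endpoints. *)
have main x' y' X' Y' m' n' : s x' = Some (X', m') -> s y' = Some (Y', n') ->
    X' != Y' -> Y' != Z ->
    step x' y' (step z w Phi) s = step x' y' Phi (put Z o.+1 s).
  move=> {sx sy xX yY X Y m n nXY} sx sy nXY nYZ.
  move: (X') (Y') (m') (n') sx sy nXY nYZ => {X' Y' m' n'} X Y m n sx sy nXY nYZ.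
  have xX := wf_mem ws sx; have yY := wf_mem ws sy.
  have nZY : Z != Y by rewrite eq_sym.
  have nYX : Y != X by rewrite eq_sym.
  have dZY := wf_disjoint ws sz sy nZY.
  rewrite (step_edge _ nXY sx sy) (step_loop _ sz sw).
  have [eZ|nZ] := eqVneq X Z.
    have em : m = o by move: sx; rewrite eZ => /(wf_eq ws)/(_ sz).
    rewrite -{}eZ -{}em in zZ wZ sz sw nYZ nZY dZY *.
    rewrite (@step_loop _ _ _ _ (X :|: Y) (m + n)%N (m + n)%N) ?updE ?inE ?zZ ?wZ //.
    rewrite step_deadl ?updE ?zZ //.
    rewrite (@step_loop _ _ _ _ X m m) ?updE ?(wf_other ws sz sy) ?(wf_other ws sw sy) //.
    rewrite step_deadl ?updE ?inE ?zZ //.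
    rewrite (@step_edge _ _ _ _ X m.+1 Y n) ?updE ?xX ?(wf_other ws sy sx) //.
    rewrite /put /kill !(upd_absorb (B := X :|: Y)) ?subsetUl ?subxx //.
    by rewrite (upd_absorb (B := X) (B' := X)) // (upd_swap (B := Y) (B' := X)) // disjoint_sym.
  have nZX : Z != X by rewrite eq_sym.
  have dZX := wf_disjoint ws sz sx nZX.
  have dZXY : [disjoint Z & X :|: Y] by rewrite disjoint_sym disjointsU // disjoint_sym.
  rewrite !(@step_loop z w _ _ Z o o) ?updE ?inE
    ?(wf_other ws sz sx) ?(wf_other ws sz sy) ?(wf_other ws sw sx) ?(wf_other ws sw sy) //.
  rewrite (@step_edge _ _ _ _ X m Y n) ?updE ?(wf_other ws sx sz) ?(wf_other ws sy sz) //.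
  by rewrite /put /kill !(upd_swap (B := Z)).
have satZ := saturated_block ws sz.
have [eYZ|nYZ] := eqVneq Y Z; last exact: main sx sy nXY nYZ.
rewrite stepC // [RHS]stepC; last exact: wf_put.
by apply: main sy sx _ _; rewrite -?eYZ // eq_sym.
Qed.

Lemma step_comm_adjacent x y z w Phi s X Y Z m n o : wf s ->
  s x = Some (X, m) -> s y = Some (Y, n) -> s z = Some (X, m) -> s w = Some (Z, o) ->
  X != Y -> X != Z -> Y != Z ->
  step x y (step z w Phi) s = step z w (step x y Phi) s.
Proof.
move=> ws sx sy sz sw nXY nXZ nYZ.
have nYX : Y != X by rewrite eq_sym.
have nZX : Z != X by rewrite eq_sym.
have nZY : Z != Y by rewrite eq_sym.
have xX := wf_mem ws sx; have zX := wf_mem ws sz.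
have yY := wf_mem ws sy; have wZ := wf_mem ws sw.
have xY := wf_other ws sx sy nXY; have xZ := wf_other ws sx sw nXZ.
have zY := wf_other ws sz sy nXY; have zZ := wf_other ws sz sw nXZ.
have yX := wf_other ws sy sx nYX; have yZ := wf_other ws sy sw nYZ.
have wX := wf_other ws sw sx nZX; have wY := wf_other ws sw sy nZY.
have nXYZ : X :|: Y != Z.
  by apply/eqP => e; move: xZ; rewrite -e inE xX.
have nXZY : X :|: Z != Y.
  by apply/eqP => e; move: xY; rewrite -e inE xX.
rewrite (step_edge _ nXY sx sy) [RHS](step_edge _ nXZ sz sw).
rewrite (step_edge _ nXZ sz sw) (step_edge _ nXY sx sy).
rewrite (@step_edge z w _ _ (X :|: Y) (m + n) Z o) ?updE ?inE ?zX ?wX ?wY //.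
rewrite (@step_edge x y _ _ (X :|: Z) (m + o) Y n) ?updE ?inE ?xX ?yX ?yZ //.
rewrite (@step_deadl z w _ (kill X s)) ?updE ?zX //.
rewrite (@step_deadl x y _ (kill X s)) ?updE ?xX //.
rewrite (@step_deadl z w _ (kill (X :|: Y) s)) ?updE ?inE ?zX //.
rewrite (@step_deadl x y _ (kill (X :|: Z) s)) ?updE ?inE ?xX //.
rewrite (@step_edge z w _ _ X m Z o) ?updE ?zY ?wY //.
rewrite (@step_edge x y _ _ X m Y n) ?updE ?xZ ?yZ //.
rewrite !killU.
rewrite (setUAC X Z Y) (addnAC m o n).
have dXYZ : [disjoint Z & X :|: Y].
  by rewrite disjoint_sym disjointsU //; [exact: (wf_disjoint ws sx sw) | exact: (wf_disjoint ws sy sw)].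
have dXZY : [disjoint Y & X :|: Z].
  by rewrite disjoint_sym disjointsU //; [exact: (wf_disjoint ws sx sy) | exact: (wf_disjoint ws sw sy)].
rewrite /put /kill.
have subZ : X :|: Z \subset X :|: Y :|: Z by rewrite setUAC subsetUl.
rewrite !(upd_absorb (B := X :|: Y :|: Z)) ?subsetUl //.
rewrite (upd_absorb (B := X :|: Y) (B' := X :|: Y)) // (upd_absorb (B := X :|: Z) (B' := X :|: Z)) //.
rewrite (upd_swap (B := Z) (B' := X :|: Y)) // (upd_swap (B := Y) (B' := X :|: Z)) //.
rewrite (setUC Z Y).
(* Only two states remain unmatched. [kill (X :|: Y) s] has coefficient [b c + c^2 + d] on the left
   (merge then delete, delete [Y] then [X], delete both at once) and [a d] on the right; for
   [kill (X :|: Z) s] the sides are exchanged. *)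
apply/eqP; rewrite -subr_eq0; apply/eqP.
rewrite -[RHS](mul0r (Phi (upd (X :|: Y) None s) - Phi (upd (X :|: Z) None s))) -q0.
ring.
Qed.

(** No block is shared, so the 25 terms of the two expansions agree once updates of disjoint sets
    are exchanged. *)
Lemma step_comm_disjoint x y z w Phi s X Y Z W m n o p : wf s ->
  s x = Some (X, m) -> s y = Some (Y, n) -> s z = Some (Z, o) -> s w = Some (W, p) ->
  X != Y -> Z != W -> X != Z -> X != W -> Y != Z -> Y != W ->
  step x y (step z w Phi) s = step z w (step x y Phi) s.
Proof.
move=> ws sx sy sz sw nXY nZW nXZ nXW nYZ nYW.
have xZ := wf_other ws sx sz nXZ; have xW := wf_other ws sx sw nXW.
have yZ := wf_other ws sy sz nYZ; have yW := wf_other ws sy sw nYW.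
have zX := wf_other ws sz sx (contra_neq esym nXZ).
have zY := wf_other ws sz sy (contra_neq esym nYZ).
have wX := wf_other ws sw sx (contra_neq esym nXW).
have wY := wf_other ws sw sy (contra_neq esym nYW).
rewrite (step_edge _ nXY sx sy) [RHS](step_edge _ nZW sz sw).
rewrite !(@step_edge z w _ _ Z o W p) ?updE ?inE ?zX ?zY ?wX ?wY //.
rewrite !(@step_edge x y _ _ X m Y n) ?updE ?inE ?xZ ?xW ?yZ ?yW //.
have dis := wf_disjoint ws.
have dXZ := dis _ _ _ _ _ _ sx sz nXZ; have dXW := dis _ _ _ _ _ _ sx sw nXW.
have dYZ := dis _ _ _ _ _ _ sy sz nYZ; have dYW := dis _ _ _ _ _ _ sy sw nYW.
have dU A B C : [disjoint A & B] -> [disjoint A & C] -> [disjoint A & B :|: C].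
  by rewrite ![[disjoint A & _]]disjoint_sym; apply: disjointsU.
have dXU := dU _ _ _ dXZ dXW; have dYU := dU _ _ _ dYZ dYW.
have dUZ := disjointsU dXZ dYZ; have dUW := disjointsU dXW dYW.
have dUU := disjointsU dXU dYU.
rewrite /put /kill !(upd_swap (B := X :|: Y)) // !(upd_swap (B := X)) // !(upd_swap (B := Y)) //.
ring.
Qed.

(** In the main case both edges join the same two blocks. Whichever goes first, the other survives,
    becomes a loop of the merged block, or vanishes, so the expansions agree term by term. *)
Lemma step_comm_parallel x y z w Phi s : wf s -> s x = s z -> s y = s w ->
  step x y (step z w Phi) s = step z w (step x y Phi) s.
Proof.
move=> ws exz eyw.
case sx: (s x) => [[X m]|]; last by rewrite [RHS]step_comm_dead //; left.
case sy: (s y) => [[Y n]|]; last by rewrite [RHS]step_comm_dead //; right.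
have sz := sx; have sw := sy; rewrite exz in sz; rewrite eyw in sw.
have [eXY|nXY] := eqVneq X Y.
  have en : m = n by move: sx; rewrite eXY => /(wf_eq ws)/(_ sy).
  by apply: (@step_comm_loop _ _ _ _ _ _ X m); rewrite ?sz ?sw // eXY en.
have xX := wf_mem ws sx; have zX := wf_mem ws sz.
have yY := wf_mem ws sy; have wY := wf_mem ws sw.
rewrite (step_edge _ nXY sx sy) [RHS](step_edge _ nXY sz sw).
congr (_ * _ + _ * _ + _ * _ + _ * _ + _ * _).
- by rewrite (step_edge _ nXY sx sy) (step_edge _ nXY sz sw).
- by rewrite !(@step_loop _ _ _ _ (X :|: Y) (m + n) (m + n)) ?updE ?inE ?xX ?zX ?yY ?wY ?orbT.
- by rewrite !step_deadl ?updE ?xX ?zX.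
- by rewrite !step_deadr ?updE ?yY ?wY.
- by rewrite !step_deadl ?updE ?inE ?xX ?zX.
Qed.

Lemma step_comm x y z w Phi s : wf s ->
  step x y (step z w Phi) s = step z w (step x y Phi) s.
Proof.
move=> ws.
case sz: (s z) => [[Z o]|]; last by apply: step_comm_dead => //; left.
case sw: (s w) => [[W p]|]; last by apply: step_comm_dead => //; right.
case sx: (s x) => [[X m]|]; last by rewrite [RHS]step_comm_dead //; left.
case sy: (s y) => [[Y n]|]; last by rewrite [RHS]step_comm_dead //; right.
have same p1 p2 P k1 k2 : s p1 = Some (P, k1) -> s p2 = Some (P, k2) -> s p1 = s p2.
  by move=> h1 h2; rewrite h1 h2 (wf_eq ws h1 h2).
have [eZW|nZW] := eqVneq Z W.
  rewrite -eZW in sw; apply: (step_comm_loop _ _ _ ws sz).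
  by rewrite -sz; apply: same sw sz.
have [eXY|nXY] := eqVneq X Y.
  rewrite -eXY in sy; symmetry; apply: (step_comm_loop _ _ _ ws sx).
  by rewrite -sx; apply: same sy sx.
have sxy Psi : step x y Psi s = step y x Psi s by exact: stepC.
have szw Psi : step z w Psi s = step w z Psi s by exact: stepC.
have inner x' y' z' w' : step x' y' (step z' w' Phi) s = step x' y' (step w' z' Phi) s.
  by apply: eq_step => // s' ws'; apply: stepC.
(* Two edges sharing the block of their first endpoints are parallel or adjacent; the other ways of
   sharing a block reduce to this by turning edges around. *)
have adj x' y' z' w' X' Y' Z' W' m' n' o' p' :
    s x' = Some (X', m') -> s y' = Some (Y', n') -> s z' = Some (Z', o') ->
    s w' = Some (W', p') -> X' != Y' -> Z' != W' -> X' = Z' ->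
    step x' y' (step z' w' Phi) s = step z' w' (step x' y' Phi) s.
  move=> sx' sy' sz' sw' n1 n2 e; rewrite -e in sz' n2.
  have exz := same _ _ _ _ _ sx' sz'.
  have [eYW|nYW] := eqVneq Y' W'.
    by rewrite -eYW in sw'; apply: step_comm_parallel => //; apply: same sy' sw'.
  by apply: (step_comm_adjacent _ ws sx' sy' _ sw'); rewrite -?exz.
have [eXZ|nXZ] := eqVneq X Z; first exact: adj sx sy sz sw nXY nZW eXZ.
have nYX : Y != X by rewrite eq_sym.
have nWZ : W != Z by rewrite eq_sym.
have [eXW|nXW] := eqVneq X W.
  by rewrite inner szw; apply: adj sx sy sw sz nXY nWZ eXW.
have [eYZ|nYZ] := eqVneq Y Z.
  by rewrite sxy [RHS]inner; apply: adj sy sx sz sw nYX nZW eYZ.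
have [eYW|nYW] := eqVneq Y W.
  by rewrite inner sxy szw [RHS]inner; apply: adj sy sx sw sz nYX nWZ eYW.
exact: step_comm_disjoint sx sy sz sw nXY nZW nXZ nXW nYZ nYW.
Qed.

(** * Independence of the order of the edges *)

(** The ends of an edge form an unordered pair, so an orientation has to be picked; [stepC] makes
    the choice irrelevant on well-formed states. *)
Definition edge_step A Phi s : R :=
  if [pick xy : V * V | A == [set xy.1; xy.2]] is Some xy
  then step xy.1 xy.2 Phi s else Phi s.

Lemma edge_step2 x y Phi s : wf s -> edge_step [set x; y] Phi s = step x y Phi s.
Proof.
move=> ws; rewrite /edge_step; case: pickP => [[p q] /= /eqP e|/(_ (x, y))]; last first.
  by rewrite eqxx.
have: p \in [set x; y] by rewrite e set21.
have: q \in [set x; y] by rewrite e set22.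
have: x \in [set p; q] by rewrite -e set21.
have: y \in [set p; q] by rewrite -e set22.
rewrite !inE => hy hx /orP[]/eqP eq /orP[]/eqP ep; move: hx hy; rewrite ep eq ?orbb //.
- by move=> _ /eqP->.
- by move=> *; rewrite stepC.
- by move=> /eqP->.
Qed.

Lemma eq_edge_step A Phi Phi' s :
  wf s -> (forall s', wf s' -> Phi s' = Phi' s') ->
  edge_step A Phi s = edge_step A Phi' s.
Proof. by move=> ws e; rewrite /edge_step; case: pickP => *; [apply: eq_step | apply: e]. Qed.

Lemma edge_step_comm A B Phi s : wf s ->
  edge_step A (edge_step B Phi) s = edge_step B (edge_step A Phi) s.
Proof.
move=> ws; rewrite /edge_step; case: pickP => [[x y] _|_] //=.
by case: pickP => // -[z w] _ /=; apply: step_comm.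
Qed.

(** With no edge left, rules (2) and (3) give one factor per block. Since the entries carry their
    vertex sets, [undup] lists each block once without identifying blocks that have equally many
    loops. *)
Definition final_value s : R := \prod_(t <- undup (pmap s (enum V))) f t.2.

Definition run (E : seq {set V}) : state -> R := foldr edge_step final_value E.

(** By commutation any edge can be moved to the front of the list, and two rearrangements are then
    compared by induction. *)
Lemma run_perm E E' s : perm_eq E E' -> wf s -> run E s = run E' s.
Proof.
have front A E1 E2 s' : wf s' -> run (E1 ++ A :: E2) s' = run (A :: E1 ++ E2) s'.
  elim: E1 s' => [|B E1 IH] s' ws //=.
  rewrite edge_step_comm //; apply: eq_edge_step => // *; exact: IH.
elim: E E' s => [|A E IH] E' s; first by rewrite perm_sym => /perm_nilP->.
move=> pE ws; have AE' : A \in E' by rewrite -(perm_mem pE) mem_head.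
case/splitPr: AE' pE => E1 E2; rewrite perm_sym -cat1s perm_catCA perm_cons perm_sym => pE.
by rewrite front //=; apply: eq_edge_step => // s' ws'; apply: IH.
Qed.

End Operators.
End BlockStates.

(** * Comparing the states of a graph with those of its minors *)

Section Pullback.
Variables (V W : finType) (k : V -> option W).

Definition pre (B : {set W}) : {set V} := [set p | if k p is Some w then w \in B else false].

Definition lift_block (h : {set W} -> {set V}) (t : {set W} * nat) := (h t.1, t.2).

(** Here [k] describes the passage to a minor: deleted vertices go to [None], merged vertices to the
    same image. States of the minor become states over the original vertex set. *)
Definition pull (s : state W) : state V :=
  [ffun p => omap (lift_block pre) (obind s (k p))].

Lemma preU B C : pre (B :|: C) = pre B :|: pre C.
Proof. by apply/setP=> p; rewrite !inE; case: (k p) => // w; rewrite inE. Qed.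

Lemma pull_upd B o s : pull (upd B o s) = upd (pre B) (omap (lift_block pre) o) (pull s).
Proof.
apply/ffunP=> p; rewrite !ffunE inE; case: (k p) => //= w.
by rewrite updE; case: ifP.
Qed.

Lemma pull_wf s : wf s -> wf (pull s).
Proof.
move=> ws p B n; rewrite ffunE; case kp: (k p) => [w|] //=.
case sw: (s w) => [[C m]|] //= [<- <-]; have [wC h] := ws _ _ _ sw.
split=> [|q]; first by rewrite inE kp.
by rewrite inE ffunE; case: (k q) => // w' /h /= ->.
Qed.

(** The ends of an edge in the minor, or [None] when the edge is lost with a deleted endpoint. *)
Definition kimage (A : {set V}) : option {set W} :=
  if [forall x in A, k x] then Some [set w | [exists x in A, k x == Some w]] else None.

Lemma kimage2 x y : kimage [set x; y] =
  if (k x, k y) is (Some x', Some y') then Some [set x'; y'] else None.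
Proof.
rewrite /kimage; case: ifP => [/forall_inP h|/negbT].
  have := h x (set21 _ _); have := h y (set22 _ _).
  case kx: (k x) => [x'|] //; case ky: (k y) => [y'|] // _ _; congr Some.
  apply/setP=> w; rewrite !inE; apply/exists_inP/orP => [[p]|[]/eqP->].
  - by rewrite !inE => /orP[]/eqP->; rewrite ?kx ?ky => /eqP[->]; rewrite eqxx; auto.
  - by exists x; rewrite ?set21 ?kx.
  - by exists y; rewrite ?set22 ?ky.
rewrite negb_forall => /existsP[p]; rewrite negb_imply !inE => /andP[/orP[]/eqP->].
  by case: (k x).
by case: (k x) => // ?; case: (k y).
Qed.

Hypothesis k_onto : forall w, exists v, k v = Some w.

Lemma pre_inj : injective pre.
Proof.
move=> B C /setP e; apply/setP=> w; have [v kv] := k_onto w.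
by have := e v; rewrite !inE kv.
Qed.

Variables (R : comNzRingType) (a b c d : R) (f : nat -> R).

Lemma step_pull x y x' y' Phi s : k x = Some x' -> k y = Some y' ->
  step a b c d x y Phi (pull s) = step a b c d x' y' (Phi \o pull) s.
Proof.
move=> kx ky; rewrite /step !ffunE kx ky /=.
case: (s x') => [[X m]|] //=; case: (s y') => [[Y n]|] //=.
by rewrite (inj_eq pre_inj) /put /kill !pull_upd /= /lift_block /= !preU.
Qed.

Lemma step_pull_dead x y Phi s : k x = None \/ k y = None ->
  step a b c d x y Phi (pull s) = Phi (pull s).
Proof.
by case=> e; [apply: step_deadl | apply: step_deadr]; rewrite ffunE e.
Qed.

(** Since [k] is onto, distinct blocks keep distinct preimages, and every block recorded in [s] is
    still recorded at some vertex of [V]. *)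
Lemma final_value_pull s : final_value f (pull s) = final_value f s.
Proof.
rewrite /final_value.
have li : injective (lift_block pre) by move=> [B m] [C n] [/pre_inj-> ->].
rewrite (perm_big (map (lift_block pre) (undup (pmap s (enum W))))) /=.
  by rewrite big_map.
apply: uniq_perm; rewrite ?undup_uniq ?map_inj_uniq ?undup_uniq // => t.
rewrite mem_undup mem_pmap; apply/mapP/mapP => [[p _]|[t']].
  rewrite ffunE; case: (k p) => //= w; case sw: (s w) => [t'|] //= [->].
  by exists t' => //; rewrite mem_undup mem_pmap -sw map_f ?mem_enum.
rewrite mem_undup mem_pmap => /mapP[w _ sw] ->; have [v kv] := k_onto w.
by exists v; rewrite ?mem_enum // ffunE kv /= -sw.
Qed.

(** An edge with a deleted endpoint acts trivially on a pulled back state, and [pmap] drops it;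
    every other edge acts through its image. *)
Lemma run_pull E s : all (@is_upair V) E -> wf s ->
  run a b c d f E (pull s) = run a b c d f (pmap kimage E) s.
Proof.
elim: E s => [|A E IH] s /=; first by rewrite final_value_pull.
case/andP=> /existsP[x /existsP[y /eqP->]] uE ws.
rewrite edge_step2 ?kimage2; last exact: pull_wf.
case kx: (k x) => [x'|]; last by rewrite step_pull_dead ?IH //; left.
case ky: (k y) => [y'|]; last by rewrite step_pull_dead ?IH //; right.
rewrite (step_pull _ _ kx ky) /= edge_step2 //.
by apply: eq_step => // s' ws'; apply: IH.
Qed.

End Pullback.

(** * Multiplicativity on disjoint unions *)

Section Union.
Variables (V1 V2 : finType).

Definition union_state (s1 : state V1) (s2 : state V2) : state (V1 + V2)%type :=
  [ffun p => match p with
   | inl x => omap (lift_block (fun B => inl @: B)) (s1 x)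
   | inr y => omap (lift_block (fun B => inr @: B)) (s2 y)
   end].

Let inl_i : injective (@inl V1 V2). Proof. by move=> x y []. Qed.
Let inr_i : injective (@inr V1 V2). Proof. by move=> x y []. Qed.

Lemma inr_inl (A : {set V1}) (y : V2) : (inr y \in [set inl x | x in A]) = false.
Proof. by apply/negP => /imsetP[]. Qed.

Lemma inl_inr (A : {set V2}) (x : V1) : (inl x \in [set inr y | y in A]) = false.
Proof. by apply/negP => /imsetP[]. Qed.

Lemma union_updl B o s1 s2 : union_state (upd B o s1) s2 =
  upd [set inl x | x in B] (omap (lift_block (fun B => inl @: B)) o) (union_state s1 s2).
Proof.
apply/ffunP=> -[x|y]; rewrite !ffunE ?inr_inl //.
by rewrite mem_imset // ?updE; case: ifP.
Qed.

Lemma union_updr B o s1 s2 : union_state s1 (upd B o s2) =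
  upd [set inr x | x in B] (omap (lift_block (fun B => inr @: B)) o) (union_state s1 s2).
Proof.
apply/ffunP=> -[x|y]; rewrite !ffunE ?inl_inr //.
by rewrite mem_imset // ?updE; case: ifP.
Qed.

Lemma union_wf s1 s2 : wf s1 -> wf s2 -> wf (union_state s1 s2).
Proof.
move=> w1 w2 [x|y] B n; rewrite ffunE.
  case sx: (s1 x) => [[X m]|] //= [<- <-]; have [xX h] := w1 _ _ _ sx.
  split=> [|_ /imsetP[q /h sq ->]]; first exact: imset_f.
  by rewrite ffunE sq.
case sy: (s2 y) => [[X m]|] //= [<- <-]; have [xX h] := w2 _ _ _ sy.
split=> [|_ /imsetP[q /h sq ->]]; first exact: imset_f.
by rewrite ffunE sq.
Qed.

Variables (R : comNzRingType) (a b c d : R) (f : nat -> R).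

Lemma step_unionl x y Phi s1 s2 :
  step a b c d (inl x) (inl y) Phi (union_state s1 s2) =
  step a b c d x y (fun s => Phi (union_state s s2)) s1.
Proof.
rewrite /step !ffunE; case: (s1 x) => [[X m]|] //=; case: (s1 y) => [[Y n]|] //=.
by rewrite (inj_eq (imset_inj inl_i)) /put /kill !union_updl /= /lift_block /= !imsetU.
Qed.

Lemma step_unionr x y Phi s1 s2 :
  step a b c d (inr x) (inr y) Phi (union_state s1 s2) =
  step a b c d x y (fun s => Phi (union_state s1 s)) s2.
Proof.
rewrite /step !ffunE; case: (s2 x) => [[X m]|] //=; case: (s2 y) => [[Y n]|] //=.
by rewrite (inj_eq (imset_inj inr_i)) /put /kill !union_updr /= /lift_block /= !imsetU.
Qed.

Lemma step_mulr (V : finType) x y Phi r (s : state V) :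
  step a b c d x y (fun s => Phi s * r) s = step a b c d x y Phi s * r.
Proof.
rewrite /step; case: (s x) => [[X m]|] //=; case: (s y) => [[Y n]|] //=.
by case: ifP => // _; ring.
Qed.

Lemma step_mull (V : finType) x y Phi r (s : state V) :
  step a b c d x y (fun s => r * Phi s) s = r * step a b c d x y Phi s.
Proof.
rewrite /step; case: (s x) => [[X m]|] //=; case: (s y) => [[Y n]|] //=.
by case: ifP => // _; ring.
Qed.

Lemma final_value_union s1 s2 : wf s1 -> wf s2 ->
  final_value f (union_state s1 s2) = final_value f s1 * final_value f s2.
Proof.
move=> w1 w2; rewrite /final_value.
pose l1 := lift_block (fun B : {set V1} => [set @inl V1 V2 x | x in B]).
pose l2 := lift_block (fun B : {set V2} => [set @inr V1 V2 x | x in B]).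
have i1 : injective l1 by move=> [B m] [C n] [/(imset_inj inl_i)-> ->].
have i2 : injective l2 by move=> [B m] [C n] [/(imset_inj inr_i)-> ->].
have m1 t : t \in undup (pmap s1 (enum V1)) -> exists2 x, s1 x = Some t & x \in t.1.
  rewrite mem_undup mem_pmap => /mapP[x _ /esym sx]; exists x => //.
  by case: t sx => B n /w1[].
have m2 t : t \in undup (pmap s2 (enum V2)) -> exists2 x, s2 x = Some t & x \in t.1.
  rewrite mem_undup mem_pmap => /mapP[x _ /esym sx]; exists x => //.
  by case: t sx => B n /w2[].
rewrite (perm_big (map l1 (undup (pmap s1 (enum V1))) ++ map l2 (undup (pmap s2 (enum V2))))).
  by rewrite big_cat !big_map.
apply: uniq_perm; rewrite ?undup_uniq //.
  rewrite cat_uniq !map_inj_uniq ?undup_uniq //= andbT.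
  apply/hasPn => _ /mapP[t2 /m2[y _ yt] ->]; apply/mapP => -[t1 _ [/setP/(_ (inr y))]].
  by rewrite inr_inl imset_f.
move=> t; rewrite mem_undup mem_pmap mem_cat; apply/mapP/orP => [[[x|y] _]|[]/mapP[t']].
- rewrite ffunE; case sx: (s1 x) => [t'|] //= [->]; left.
  by rewrite (map_f l1) // mem_undup mem_pmap -sx map_f ?mem_enum.
- rewrite ffunE; case sx: (s2 y) => [t'|] //= [->]; right.
  by rewrite (map_f l2) // mem_undup mem_pmap -sx map_f ?mem_enum.
- by case/m1=> x sx _ ->; exists (inl x); rewrite ?mem_enum // ffunE sx.
- by case/m2=> x sx _ ->; exists (inr x); rewrite ?mem_enum // ffunE sx.
Qed.

(** An edge of one component changes only that part of the state. As [step] is linear, the value of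
    the other component passes through as a constant factor. *)
Lemma run_union E1 E2 s1 s2 :
  all (@is_upair V1) E1 -> all (@is_upair V2) E2 -> wf s1 -> wf s2 ->
  run a b c d f ([seq [set inl x | x in A] | A : {set V1} <- E1] ++
                 [seq [set inr x | x in A] | A : {set V2} <- E2]) (union_state s1 s2)
  = run a b c d f E1 s1 * run a b c d f E2 s2.
Proof.
elim: E1 s1 => [|A E1 IH] s1 /= u1 u2 w1 w2.
  elim: E2 s2 u2 w2 => [|A E2 IH] s2 /=; first by move=> *; apply: final_value_union.
  case/andP=> /existsP[x /existsP[y /eqP->]] u2 w2.
  rewrite imsetU !imset_set1 !edge_step2 //; last exact: union_wf.
  rewrite step_unionr -step_mull; apply: eq_step => // s' w'; exact: IH.
case/andP: u1 => /existsP[x /existsP[y /eqP->]] u1.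
rewrite imsetU !imset_set1 !edge_step2 //; last exact: union_wf.
rewrite step_unionl -step_mulr; apply: eq_step => // s' w'; exact: IH.
Qed.

End Union.

(** * The invariant for vanishing [q] *)

Section GraphValue.
Variables (R : comNzRingType) (a b c d : R) (f : nat -> R).
Hypothesis q0 : b * c + c ^+ 2 + d - a * d = 0.

Definition graph_value (G : mgraph) : R :=
  run a b c d f [seq ends G e | e <- enum (edge G)] (discrete (vert G)).

Lemma all_upair_ends (G : mgraph) (l : seq (edge G)) :
  all (@is_upair _) [seq ends G e | e <- l].
Proof. by apply/allP => _ /mapP[e _ ->]; apply: endsP. Qed.

(** Common form of isomorphism, edge deletion, contraction and vertex deletion: [k] maps the
    vertices, and [j] embeds the edges of [H] as those in [D] that lose no endpoint. The edge lists
    agree up to order, which [run_perm] ignores. *)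
Lemma run_minor (G H : mgraph) (D : pred (edge G)) (k : vert G -> option (vert H))
    (j : edge H -> edge G) :
  (forall w, exists v, k v = Some w) -> injective j ->
  (forall e, (e \in codom j) = D e && kimage k (ends G e)) ->
  (forall e, kimage k (ends G (j e)) = Some (ends H e)) ->
  run a b c d f [seq ends G e | e <- enum (edge G) & D e] (pull k (discrete _))
  = graph_value H.
Proof.
move=> k_onto j_inj j_codom kj; have wd := @wf_discrete (vert H).
rewrite run_pull ?all_upair_ends //; apply: run_perm => //.
have pmapE (l : seq (edge G)) : pmap (kimage k) (map (ends G) l) =
    pmap (fun e => kimage k (ends G e)) [seq e <- l | kimage k (ends G e)].
  by elim: l => //= e l ->; case ke: (kimage k _) => //=; rewrite ke.
rewrite pmapE -filter_predI.
have -> : [seq ends H e | e <- enum (edge H)] =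
    pmap (fun e => kimage k (ends G e)) (map j (enum (edge H))).
  by elim: (enum _) => //= e l ->; rewrite kj.
apply: perm_pmap; apply: uniq_perm.
- by apply/filter_uniq/enum_uniq.
- by rewrite map_inj_uniq // enum_uniq.
move=> e; rewrite mem_filter mem_enum andbT /= andbC -j_codom.
by [].
Qed.

Lemma kimage_total (V W : finType) (h : V -> W) (A : {set V}) :
  kimage (fun x => Some (h x)) A = Some (h @: A).
Proof.
rewrite /kimage; case: forall_inP => [_|[]] //; congr Some; apply/setP=> w.
rewrite inE; apply/exists_inP/imsetP => [[x xA /eqP[<-]]|[x xA ->]]; by exists x.
Qed.

Lemma graph_value_iso : graph_invariant graph_value.
Proof.
move=> G H [hv [he [[hv' hvK hvK'] [he' heK heK'] E]]].
rewrite -(@run_minor G H predT (fun x => Some (hv x)) he'); first last.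
- by move=> e; rewrite kimage_total -E heK'.
- move=> e; rewrite kimage_total; apply/codomP; exists (he e); by rewrite heK.
- exact: can_inj heK'.
- by move=> w; exists (hv' w); rewrite hvK'.
rewrite filter_predT; congr run; apply/ffunP=> p; rewrite !ffunE /= ffunE /lift_block /=.
congr (Some (_, _)); apply/setP=> x; rewrite !inE (can_eq hvK) //.
Qed.

Lemma graph_value_del_edge (G : mgraph) (e : edge G) :
  graph_value (del_edge e) =
  run a b c d f [seq ends G x | x <- enum (edge G) & x != e] (discrete _).
Proof.
rewrite -(@run_minor G (del_edge e) (predC1 e) Some val); first last.
- by move=> x; rewrite (kimage_total id) imset_id.
- move=> x; rewrite (kimage_total id) andbT; apply/codomP/idP => [[y ->]|xe]; first exact: valP y.
  by exists (exist _ x xe).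
- exact: val_inj.
- by move=> w; exists w.
congr run; apply/ffunP=> p; rewrite !ffunE /= ffunE /lift_block /=.
congr (Some (_, _)); apply/setP=> x; by rewrite !inE.
Qed.

Lemma contract_vert_eq (G : mgraph) (e : edge G) (x y : vert G) :
  (contract_vert e x == contract_vert e y) =
  (x == y) || (x \in ends G e) && (y \in ends G e).
Proof.
rewrite /contract_vert; case: insubP => [x' xe ex|]; case: insubP => [y' ye ey|].
- by rewrite (negbTE xe) orbF -ex -ey val_eqE.
- rewrite negbK => ye; apply/esym/negP; rewrite (negbTE xe) orbF => /eqP exy.
  by rewrite exy ye in xe.
- rewrite negbK => xe; apply/esym/negP; rewrite (negbTE ye) andbF orbF => /eqP exy.
  by rewrite -exy xe in ye.
- by rewrite !negbK => -> ->; rewrite orbT eqxx.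
Qed.

(** The merged block starts with no loop: edges parallel to [e] are still in the list and become
    loops when they are processed. *)
Lemma graph_value_contract (G : mgraph) (e : edge G) :
  graph_value (contract e) =
  run a b c d f [seq ends G x | x <- enum (edge G) & x != e]
    (put (ends G e) 0 (discrete _)).
Proof.
rewrite -(@run_minor G (contract e) (predC1 e) (fun x => Some (contract_vert e x)) val); first last.
- by move=> x; rewrite kimage_total.
- move=> x; rewrite kimage_total andbT; apply/codomP/idP => [[y ->]|xe]; first exact: valP y.
  by exists (exist _ x xe).
- exact: val_inj.
- case=> [w|]; first by exists (val w); rewrite /contract_vert valK.
  have /existsP[x /existsP[y /eqP exy]] := endsP e.
  by exists x; rewrite /contract_vert insubF // exy set21.
congr run; apply/ffunP=> p; rewrite !ffunE /= ffunE /lift_block /=.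
case: ifP => pe; congr (Some (_, _)); apply/setP=> x.
  by rewrite !inE contract_vert_eq pe andbT; case: eqP => //= ->.
by rewrite !inE contract_vert_eq pe andbF orbF.
Qed.

(** An edge [e] meeting [A] is lost anyway, so it may be left out of the list; all minors in rule
    (1) then use the same edge list. *)
Lemma graph_value_del_verts (G : mgraph) (e : edge G) (A : {set vert G}) :
  ~~ [disjoint ends G e & A] ->
  graph_value (del_verts A) =
  run a b c d f [seq ends G x | x <- enum (edge G) & x != e] (kill A (discrete _)).
Proof.
move=> eA.
have kE (B : {set vert G}) : kimage (insub : _ -> option {x | x \notin A}) B
   = if [disjoint B & A] then Some [set z | val z \in B] else None.
  rewrite /kimage; have -> : [forall x in B, isSome (insub x : option {x | x \notin A})] = [disjoint B & A].
    apply/forall_inP/idP => [h|dis x xB].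
      apply/pred0P => x /=; apply/negP => /andP[/h]; case: insubP => // u.
      by move=> /negbTE-> _.
    by rewrite insubT // (disjointFr dis xB).
  case: ifP => // dis; congr Some; apply/setP=> z; rewrite !inE.
  apply/exists_inP/idP => [[x xB /eqP]|zB]; last by exists (val z); rewrite ?valK.
  by case: insubP => // u _ ux [<-]; rewrite ux.
rewrite -(@run_minor G (del_verts A) (predC1 e) insub val); first last.
- by move=> x; rewrite kE (valP x).
- move=> x; rewrite kE; apply/codomP/andP => [[y ->]|[_]].
    rewrite (valP y) /=; split=> //; apply: contraNneq eA => <-; exact: valP y.
  by case: ifP => // dx _; exists (exist _ x dx).
- exact: val_inj.
- by move=> w; exists (val w); rewrite valK.
congr run; apply/ffunP=> p; rewrite !ffunE /=.
case: insubP => [u pA up|]; last by rewrite negbK => ->.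
rewrite (negbTE pA) /= ffunE /lift_block /=; congr (Some (_, _)); apply/setP=> x.
rewrite !inE; case: insubP => [x' _ <-|]; first by rewrite inE -up val_eqE.
by rewrite negbK => xA; apply/esym/negP => /eqP e1; rewrite -e1 xA in pA.
Qed.

(** With [e] moved to the front of the list, its operator produces the five terms of rule (1), each
    already identified with the value of a minor. *)
Lemma graph_value_edge : rule_edge a b c d graph_value.
Proof.
move=> G e u v nuv euv; have wd := @wf_discrete (vert G).
have ndis (A : {set vert G}) x : x \in ends G e -> x \in A -> ~~ [disjoint ends G e & A].
  by move=> xe xA; apply/negP => /disjointFr/(_ xe); rewrite xA.
rewrite graph_value_del_edge graph_value_contract.
rewrite (@graph_value_del_verts G e [set u]); last by rewrite (@ndis _ u) ?euv ?inE ?eqxx.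
rewrite (@graph_value_del_verts G e [set v]); last by rewrite (@ndis _ v) ?euv ?inE ?eqxx ?orbT.
rewrite (@graph_value_del_verts G e [set u; v]); last by rewrite (@ndis _ u) ?euv ?inE ?eqxx.
set l := [seq _ | x <- _ & x != e].
have -> : graph_value G = run a b c d f (ends G e :: l) (discrete _).
  apply: run_perm => //; rewrite -/(map (ends G) (e :: _)); apply: perm_map.
  apply: uniq_perm; first exact: enum_uniq.
    by rewrite /= mem_filter eqxx filter_uniq // enum_uniq.
  move=> x.
  by rewrite inE mem_filter !mem_enum andbT orbN.
rewrite /= euv edge_step2 // (@step_edge _ _ _ _ _ _ _ _ _ _ [set u] 0 [set v] 0) ?ffunE //.
by apply: contraNneq nuv => /set1_inj->.
Qed.

Lemma graph_value_munion G1 G2 :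
  graph_value (munion G1 G2) = graph_value G1 * graph_value G2.
Proof.
rewrite /graph_value -run_union ?all_upair_ends //; try exact: wf_discrete.
have -> : union_state (discrete (vert G1)) (discrete (vert G2)) = discrete (vert (munion G1 G2)).
  by apply/ffunP=> -[x|y]; rewrite !ffunE /= /lift_block /= imset_set1.
apply: run_perm => //; last exact: wf_discrete.
have -> : [seq ([set inl x | x in A] : {set vert G1 + vert G2}) | A : {set vert G1} <- map (ends G1) (enum (edge G1))] ++
    [seq [set inr x | x in A] | A : {set vert G2} <- map (ends G2) (enum (edge G2))] =
    map (ends (munion G1 G2)) (map inl (enum (edge G1)) ++ map inr (enum (edge G2))).
  by rewrite map_cat -!map_comp.
apply: perm_map.
apply: uniq_perm; first exact: enum_uniq.
  rewrite cat_uniq; apply/and3P; split.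
  - by rewrite map_inj_uniq ?enum_uniq // => ? ? [].
  - by apply/hasPn => _ /mapP[y _ ->]; apply/mapP => -[].
  - by rewrite map_inj_uniq ?enum_uniq // => ? ? [].
move=> [x|y]; rewrite mem_enum mem_cat.
  by rewrite (map_f inl) // mem_enum.
by rewrite [X in _ || X](map_f inr) ?orbT // mem_enum.
Qed.

Lemma graph_value_base : rule_base f graph_value.
Proof.
split=> [n|]; last first.
  have enum_void : enum (void : finType) = [::] by rewrite (@eq_enum _ _ pred0) ?enum0 //; case.
  by rewrite /graph_value /= enum_void /= /final_value enum_void big_nil.
rewrite /graph_value /=.
have -> : [seq [set tt] | _ <- enum 'I_n] = nseq n [set tt].
  by rewrite -[in RHS](size_enum_ord n); elim: (enum _) => //= _ l ->.
(* The number of loops already counted must vary for the induction on the loops still to be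
   processed. *)
have gen m (s : state unit) : wf s -> s tt = Some ([set tt], m) ->
    run a b c d f (nseq n [set tt]) s = f (m + n)%N.
  elim: n m s => [|n IH] m s ws st /=.
    have enum_unit : enum (unit : finType) = [:: tt].
      apply: perm_small_eq => //; apply: uniq_perm => //; first exact: enum_uniq.
      by case; apply/idP/idP; rewrite ?mem_enum.
    by rewrite /final_value enum_unit /= st /= big_seq1 addn0.
  rewrite -{1}(setUid [set tt]) edge_step2 // (step_loop _ _ _ _ _ st st).
  rewrite (IH m.+1) ?addSnnS //; last by rewrite updE set11.
  by apply: wf_put => //; apply: saturated_block st.
by rewrite (gen 0%N) //; [exact: wf_discrete | rewrite ffunE].
Qed.

(** By induction on the derivation, every choice of rules computes [graph_value], so values are
    unique. *)
Lemma value_graph_value G x : value a b c d f G x -> x = graph_value G.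
Proof.
elim=> {G x} [G e u v xd xc xu xv xuv nuv euv _ -> _ -> _ -> _ -> _ ->| G1 G2 x1 x2 _ _ _ -> _ -> | n | |
  G H x iGH _ ->].
- by rewrite -graph_value_edge.
- by rewrite graph_value_munion.
- by rewrite (graph_value_base).1.
- by rewrite (graph_value_base).2.
- exact: graph_value_iso.
Qed.

End GraphValue.

(** * Existence of values *)

Lemma inj_surj_bij (T U : finType) (h : T -> U) :
  injective h -> (forall y, exists x, h x = y) -> bijective h.
Proof.
move=> h_inj h_surj; apply: inj_card_bij => //.
rewrite -(card_codom h_inj); apply: subset_leq_card; apply/subsetP => y _.
by have [x <-] := h_surj y; apply: codom_f.
Qed.

Lemma misoI (G H : mgraph) (hv : vert G -> vert H) (he : edge G -> edge H) :
  injective hv -> (forall y, exists x, hv x = y) ->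
  injective he -> (forall y, exists x, he x = y) ->
  (forall e, ends H (he e) = hv @: ends G e) -> miso G H.
Proof. by move=> *; exists hv, he; split=> //; apply: inj_surj_bij. Qed.

Lemma edge_ends (G : mgraph) (e : edge G) : exists u v, ends G e = [set u; v].
Proof. by have /existsP[u /existsP[v /eqP]] := endsP e; exists u, v. Qed.

Lemma ends_neq0 (G : mgraph) (e : edge G) : exists u, u \in ends G e.
Proof. by have [u [v ->]] := edge_ends e; exists u; rewrite set21. Qed.

Lemma empty_iso (G : mgraph) : #|vert G| = 0%N -> miso empty_graph G.
Proof.
move=> /card0_eq G0.
apply: (@misoI empty_graph G (fun x => match x with end) (fun x => match x with end));
  try by case.
- by move=> y; have := G0 y; rewrite inE.
- by move=> e; have [u _] := ends_neq0 e; have := G0 u; rewrite inE.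
Qed.

Lemma K1_iso (G : mgraph) : #|vert G| = 1%N -> miso (K1 #|edge G|) G.
Proof.
move=> G1; have /card_gt0P[v0 _] : (0 < #|vert G|)%N by rewrite G1.
have all1 x : x = v0 by apply: (fintype_le1P _ _ _); rewrite G1.
apply: (@misoI (K1 #|edge G|) G (fun=> v0) enum_val).
- by case=> -[].
- by move=> y; exists tt.
- exact: enum_val_inj.
- by move=> e; exists (enum_rank e); rewrite enum_rankK.
- move=> e; have [u [v ->]] := edge_ends (enum_val e).
  by rewrite imset_set1 (all1 u) (all1 v) setUid.
Qed.

Lemma ends_del_verts (G : mgraph) (A : {set vert G}) (e : edge (del_verts A)) :
  val @: ends (del_verts A) e = ends G (val e).
Proof.
apply/setP=> x; apply/imsetP/idP => [[z]|xe]; first by rewrite inE => ? ->.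
have xA : x \notin A by rewrite (disjointFr (valP e) xe).
by exists (exist _ x xA); rewrite ?inE.
Qed.

(** [del_verts (~: A)] is the subgraph induced on [A]; as no edge crosses, each edge lies in exactly
    one of the two parts. *)
Lemma split_iso (G : mgraph) (A : {set vert G}) :
  (forall e, [disjoint ends G e & A] || [disjoint ends G e & ~: A]) ->
  miso (munion (del_verts A) (del_verts (~: A))) G.
Proof.
move=> dA.
pose hv (x : vert (munion (del_verts A) (del_verts (~: A)))) : vert G :=
  match x with inl x => val x | inr x => val x end.
pose he (x : edge (munion (del_verts A) (del_verts (~: A)))) : edge G :=
  match x with inl x => val x | inr x => val x end.
apply: (@misoI _ _ hv he).
- move=> [x|x] [y|y] /= e; try by congr (_ _); apply: val_inj.
    by have := valP y; rewrite /= -e inE negbK (negbTE (valP x)).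
  by have := valP x; rewrite /= e inE negbK (negbTE (valP y)).
- move=> y; have [yA|yA] := boolP (y \in ~: A).
    by rewrite inE in yA; exists (inl (exist _ y yA)).
  by exists (inr (exist _ y yA)).
- have cap (e : edge G) : [disjoint ends G e & A] -> [disjoint ends G e & ~: A] -> False.
    have [u ue] := ends_neq0 e.
    by move=> /disjointFr/(_ ue) h /disjointFr/(_ ue); rewrite inE h.
  move=> [x|x] [y|y] /= e; try by congr (_ _); apply: val_inj.
    by case: (cap _ (valP x) (eq_ind_r (fun z => [disjoint ends G z & ~: A]) (valP y) e)).
  by case: (cap _ (eq_ind_r (fun z => [disjoint ends G z & A]) (valP y) e) (valP x)).
- move=> e; case/orP: (dA e) => de; first by exists (inl (exist _ e de)).
  by exists (inr (exist _ e de)).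
- case=> e; first transitivity (val @: ends (del_verts A) e); first by rewrite ends_del_verts.
    by rewrite /= -imset_comp.
  transitivity (val @: ends (del_verts (~: A)) e); first by rewrite ends_del_verts.
  by rewrite /= -imset_comp.
Qed.

Lemma card_del_verts (G : mgraph) (A : {set vert G}) :
  #|vert (del_verts A)| = #|~: A|.
Proof. by rewrite card_sig; apply: eq_card => x; rewrite !inE. Qed.

Section Values.
Variables (R : comNzRingType) (a b c d : R) (f : nat -> R).

(** Induction on the number of vertices plus edges. A non-loop edge allows rule (1); if all edges
    are loops, the graph is empty, a [K1 n], or splits into one vertex and the rest. *)
Lemma value_exists G : exists x, value a b c d f G x.
Proof.
have [n] := ubnP (#|vert G| + #|edge G|); elim: n G => // n IH G; rewrite ltnS => leG.
have cdel (A : {set vert G}) : (0 < #|A|)%N -> (#|vert (del_verts A)| < #|vert G|)%N.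
  move=> A0; rewrite card_del_verts -(cardsC A) -[X in (X < _)%N]add0n ltn_add2r //.
have IHdel (A : {set vert G}) : (0 < #|A|)%N -> exists x, value a b c d f (del_verts A) x.
  move=> /cdel A0; apply: IH; apply: leq_trans leG; rewrite -addSn.
  by apply: leq_add => //; rewrite card_sig; apply: max_card.
have [/existsP[e /existsP[u /existsP[v /andP[nuv /eqP euv]]]]|/existsPn loops] :=
    boolP [exists e, exists u, exists v, (u != v) && (ends G e == [set u; v])].
  have ce : (#|{: {x : edge G | x != e}}| < #|edge G|)%N.
    rewrite card_sig (@eq_card _ _ (predC1 e)) // cardC1 prednK //.
    by apply/card_gt0P; exists e.
  have [xd vd] : exists x, value a b c d f (del_edge e) x.
    by apply: IH; apply: leq_trans leG; rewrite ltn_add2l.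
  have [xc vc] : exists x, value a b c d f (contract e) x.
    apply: IH; apply: leq_trans leG; rewrite -addnS leq_add //.
    rewrite card_option card_sig -(cardsC (ends G e)) -add1n leq_add //.
      by apply/card_gt0P; exists u; rewrite euv set21.
    by rewrite subset_leq_card //; apply/subsetP => x; rewrite !inE.
  have [xu vu] := IHdel [set u] ltac:(by rewrite cards1).
  have [xv vv] := IHdel [set v] ltac:(by rewrite cards1).
  have [xuv vuv] := IHdel [set u; v] ltac:(by rewrite cards2).
  by eexists; apply: (value_edge nuv euv vd vc vu vv vuv).
case: (posnP #|vert G|) => [G0|/card_gt0P[v _]].
  by exists 1; apply: value_iso (value_empty _ _ _ _ _); apply: empty_iso.
have [G1|nG1] := eqVneq #|vert G| 1%N.
  by exists (f #|edge G|); apply: value_iso (value_K1 _ _ _ _ _ _); apply: K1_iso.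
have cv : (0 < #|~: [set v]|)%N.
  by have := cardsC [set v]; rewrite cards1; lia.
have [x1 v1] := IHdel [set v] ltac:(by rewrite cards1).
have [x2 v2] := IHdel (~: [set v]) cv.
exists (x1 * x2); apply: value_iso (value_union _ _ v1 v2).
- apply: split_iso => e; have [x [y exy]] := edge_ends e.
  have := loops e; rewrite negb_exists => /forallP/(_ x).
  rewrite negb_exists => /forallP/(_ y); rewrite exy eqxx andbT negbK => /eqP->.
  rewrite setUid !disjoints1 !inE negbK; exact: orNb.
- by rewrite /nonempty card_del_verts.
- by rewrite /nonempty card_del_verts setCK cards1.
Qed.

(** Complements [trivial], which concerns nonempty graphs only. *)
Lemma value_no_vertex G x : value a b c d f G x -> #|vert G| = 0%N -> x = 1.
Proof.
elim=> {G x} [G e u v ? ? ? ? ? _ _ _ _ _ _ _ _ _ _ _ _ /card0_eq/(_ u)||n||].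
- by rewrite inE.
- move=> G1 G2 x1 x2 n1 _ _ _ _ _; rewrite card_sum => /eqP.
  by rewrite addn_eq0 => /andP[/eqP e _]; rewrite /nonempty e in n1.
- by rewrite card_unit.
- by [].
- by move=> G H x [hv [_ [/bij_eq_card e _ _]]] _ IH H0; apply: IH; rewrite e.
Qed.

(** Only uniqueness has to be supplied: [value_exists] makes [F G] a value of [G], and each
    constructor of [value] then yields the corresponding rule for [F]. *)
Lemma functional_well_defined (F : mgraph -> R) :
  (forall G x, value a b c d f G x -> x = F G) -> well_defined a b c d f.
Proof.
move=> valF; have Fval G : value a b c d f G (F G).
  by have [x vx] := value_exists G; rewrite -(valF _ _ vx).
exists F; split=> [G x|]; first by split=> [|->]; [apply: valF | apply: Fval].
split.
- by move=> G H iGH; apply: valF; apply: value_iso iGH (Fval G).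
- by move=> G e u v nuv euv; apply/esym/valF; apply: value_edge nuv euv _ _ _ _ _.
- by move=> G1 G2 n1 n2; apply/esym/valF; apply: value_union.
- by split=> [n|]; apply/esym/valF; [apply: value_K1 | apply: value_empty].
Qed.

Lemma trivial_well_defined : trivial a b c d f -> well_defined a b c d f.
Proof.
move=> triv; apply: (@functional_well_defined (fun G => f 0 ^+ #|vert G|)) => G x vx.
case: (posnP #|vert G|) => [G0|G0]; last by apply: triv vx _ => //; apply: value_K1.
by rewrite (value_no_vertex vx G0) G0.
Qed.

End Values.

(** * Expanding a pendant path *)

Lemma disjointP (T : finType) (A B : {set T}) :
  reflect (forall x, x \in A -> x \in B -> False) [disjoint A & B].
Proof.
apply: (iffP pred0P) => h x; first by move=> xA xB; have := h x; rewrite /= xA xB.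
by apply/negP => /andP[]; apply: h.
Qed.

Lemma del_verts_iso (G H : mgraph) (A : {set vert G})
    (hv : vert H -> vert G) (he : edge H -> edge G) :
  injective hv -> (forall x, (x \in codom hv) = (x \notin A)) ->
  injective he -> (forall e, (e \in codom he) = [disjoint ends G e & A]) ->
  (forall e, ends G (he e) = hv @: ends H e) -> miso H (del_verts A).
Proof.
move=> hv_inj hvA he_inj heA E.
have hvP x : hv x \notin A by rewrite -hvA codom_f.
have heP e : [disjoint ends G (he e) & A] by rewrite -heA codom_f.
apply: (@misoI H (del_verts A) (fun x => exist _ (hv x) (hvP x)) (fun e => exist _ (he e) (heP e))).
- by move=> x y [/hv_inj].
- move=> [y yA]; have := yA; rewrite -hvA => /codomP[x ex]; exists x.
  by apply: val_inj.
- by move=> x y [/he_inj].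
- move=> [e eA]; have := eA; rewrite -heA => /codomP[x ex]; exists x.
  by apply: val_inj.
- move=> e; apply/setP=> z; rewrite inE /= E; apply/imsetP/imsetP => -[x xe ex]; exists x => //.
    by apply: val_inj.
  by rewrite ex.
Qed.

(** Here [hv] selects one representative of each vertex of the contraction, so its conditions are
    stated after composing with [contract_vert e]. *)
Lemma contract_iso (G H : mgraph) (e : edge G)
    (hv : vert H -> vert G) (he : edge H -> edge G) :
  (forall x y, contract_vert e (hv x) = contract_vert e (hv y) -> x = y) ->
  (forall v, exists x, contract_vert e (hv x) = contract_vert e v) ->
  injective he -> (forall x, (x \in codom he) = (x != e)) ->
  (forall x, contract_vert e @: ends G (he x) = contract_vert e @: (hv @: ends H x)) ->
  miso H (contract e).
Proof.
move=> hv_inj hv_surj he_inj heA E.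
have heP x : he x != e by rewrite -heA codom_f.
apply: (@misoI H (contract e) (fun x => contract_vert e (hv x)) (fun x => exist _ (he x) (heP x))) => //.
- case=> [y|]; first by have [x ex] := hv_surj (val y); exists x; rewrite ex /contract_vert valK.
  have [u ue] := ends_neq0 e; have [x ex] := hv_surj u; exists x; rewrite ex.
  by rewrite /contract_vert insubF // ue.
- by move=> x y [/he_inj].
- move=> [x xe]; have := xe; rewrite -heA => /codomP[y ey]; exists y.
  by apply: val_inj.
- by move=> x; rewrite /= E -imset_comp.
Qed.

Lemma del_verts0_iso (G : mgraph) : miso G (del_verts (set0 : {set vert G})).
Proof.
apply: (@del_verts_iso G G set0 id id) => // [x|e|e].
- by rewrite inE; apply/codomP; exists x.
- by rewrite -setI_eq0 setI0 eqxx; apply/codomP; exists e.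
- by rewrite imset_id.
Qed.

Lemma munion0l_iso G1 G2 : #|vert G1| = 0%N -> miso G2 (munion G1 G2).
Proof.
move=> /card0_eq G0; have nv (x : vert G1) : False by have := G0 x; rewrite inE.
apply: (@misoI G2 (munion G1 G2) inr inr) => //.
- by move=> x y [].
- by move=> [x|y]; [case: (nv x) | exists y].
- by move=> x y [].
- by move=> [e|y]; [have [u _] := ends_neq0 e; case: (nv u) | exists y].
Qed.

Lemma munion0r_iso G1 G2 : #|vert G2| = 0%N -> miso G1 (munion G1 G2).
Proof.
move=> /card0_eq G0; have nv (x : vert G2) : False by have := G0 x; rewrite inE.
apply: (@misoI G1 (munion G1 G2) inl inl) => //.
- by move=> x y [].
- by move=> [x|y]; [exists x | case: (nv y)].
- by move=> x y [].
- by move=> [y|e]; [exists y | have [u _] := ends_neq0 e; case: (nv u)].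
Qed.

(** * Joining two graphs by a bridge *)

Section Link.
Variables (G1 G2 : mgraph) (u : vert G1) (v : vert G2).

Definition link_ends (e : option (edge G1 + edge G2)) : {set vert G1 + vert G2} :=
  if e is Some e' then union_ends e' else [set inl u; inr v].

Lemma link_subproof e : is_upair (link_ends e).
Proof.
case: e => [e|]; first exact: union_subproof.
by apply/existsP; exists (inl u); apply/existsP; exists (inr v).
Qed.

Definition link : mgraph :=
  @MGraph (vert G1 + vert G2)%type (option (edge G1 + edge G2)) link_ends link_subproof.

Lemma link_del_edge : miso (munion G1 G2) (@del_edge link None).
Proof.
apply: (@misoI (munion G1 G2) (@del_edge link None) id (fun e => exist _ (Some e) isT)) => //.
- by move=> x; exists x.
- by move=> x y [].
- by case=> -[x|] // nx; exists x; apply: val_inj.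
- by move=> e; rewrite imset_id.
Qed.

(** Deleting an endpoint of the bridge destroys it and leaves a disjoint union. Taking [A1] or [A2]
    empty covers deletions on one side only. *)
Lemma link_del_verts (A1 : {set vert G1}) (A2 : {set vert G2}) :
  (u \in A1) || (v \in A2) ->
  miso (munion (del_verts A1) (del_verts A2))
       (@del_verts link ([set inl x | x in A1] :|: [set inr x | x in A2])).
Proof.
move=> uv; set A := _ :|: _.
have Al x : (inl x \in A) = (x \in A1) by rewrite inE inl_inr orbF mem_imset // => ? ? [].
have Ar x : (inr x \in A) = (x \in A2) by rewrite inE inr_inl mem_imset // => ? ? [].
pose hv (x : vert (munion (del_verts A1) (del_verts A2))) : vert link :=
  match x with inl x => inl (val x) | inr x => inr (val x) end.
pose he (x : edge (munion (del_verts A1) (del_verts A2))) : edge link :=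
  match x with inl x => Some (inl (val x)) | inr x => Some (inr (val x)) end.
have disl (B : {set vert G1}) : [disjoint [set inl x | x in B] & A] = [disjoint B & A1].
  apply/disjointP/disjointP => h x.
    by move=> xB xA; apply: (h (inl x)); rewrite ?Al ?imset_f.
  by case/imsetP=> y yB ->; rewrite Al; apply: h.
have disr (B : {set vert G2}) : [disjoint [set inr x | x in B] & A] = [disjoint B & A2].
  apply/disjointP/disjointP => h x.
    by move=> xB xA; apply: (h (inr x)); rewrite ?Ar ?imset_f.
  by case/imsetP=> y yB ->; rewrite Ar; apply: h.
apply: (@del_verts_iso link _ A hv he).
- by move=> [x|x] [y|y] //= [/val_inj->].
- move=> [x|x]; rewrite ?Al ?Ar; apply/codomP/idP => [[[y|y]] //= [->]|nx]; try exact: (valP y).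
    by exists (inl (exist _ x nx)).
  by exists (inr (exist _ x nx)).
- by move=> [x|x] [y|y] //= [/val_inj->].
- move=> [[e|e]|] /=; rewrite ?disl ?disr; apply/codomP/idP.
  + by case=> -[y|y] //= [->]; apply: (valP y).
  + by move=> de; exists (inl (exist _ e de)).
  + by case=> -[y|y] //= [->]; apply: (valP y).
  + by move=> de; exists (inr (exist _ e de)).
  + by case=> -[y|y].
  + move=> /disjointP h; case/orP: uv => uA.
      by case: (h (inl u)); rewrite ?set21 ?Al.
    by case: (h (inr v)); rewrite ?set22 ?Ar.
- case=> e.
    transitivity ([set inl x | x in ends G1 (val e)] : {set vert G1 + vert G2}) => //.
    by rewrite -ends_del_verts /= -!imset_comp.
  transitivity ([set inr x | x in ends G2 (val e)] : {set vert G1 + vert G2}) => //.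
  by rewrite -ends_del_verts /= -!imset_comp.
Qed.

End Link.

Local Notation K2 := (link (G1 := K1 0) (G2 := K1 0) tt tt).

Lemma link_K1_contract (G : mgraph) (u : vert G) :
  miso G (@contract (link (G2 := K1 0) u tt) None).
Proof.
apply: (@contract_iso (link (G2 := K1 0) u tt) G None inl (fun e => Some (inl e))).
- move=> x y /eqP; rewrite contract_vert_eq /= !inE !orbF.
  by case/orP => [/eqP[] //|/andP[/eqP[->] /eqP[->]]].
- move=> [x|[]]; first by exists x.
  by exists u; apply/eqP; rewrite contract_vert_eq /= set21 set22 ?orbT.
- by move=> x y [].
- by move=> [[e|[]]|] //=; apply/codomP; [exists e | case].
- by [].
Qed.

Lemma link_K2_contract (G : mgraph) (u : vert G) :
  miso (link (G2 := K1 0) u tt) (@contract (link (G2 := K2) u (inl tt)) None).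
Proof.
pose hv (x : vert (link (G2 := K1 0) u tt)) : vert (link (G2 := K2) u (inl tt)) :=
  match x with inl x => inl x | inr _ => inr (inr tt) end.
pose he (e : edge (link (G2 := K1 0) u tt)) : edge (link (G2 := K2) u (inl tt)) :=
  match e with Some (inl e) => Some (inl e) | _ => Some (inr None) end.
have cu : contract_vert (G := link (G2 := K2) u (inl tt)) None (inl u) =
    contract_vert (G := link (G2 := K2) u (inl tt)) None (inr (inl tt)).
  by apply/eqP; rewrite contract_vert_eq /= set21 set22 ?orbT.
apply: (@contract_iso (link (G2 := K2) u (inl tt)) _ None hv he).
- move=> [x|[]] [y|[]] /eqP; rewrite contract_vert_eq /= ?inE //= ?andbF ?orbF //.
  by case/orP => [/eqP[->] //|/andP[/eqP[->] /eqP[->]]].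
- move=> [x|[[]|[]]]; first by exists (inl x).
    by exists (inl u).
  by exists (inr tt).
- by move=> [[x|[]]|] // [[y|[]]|] //= [->].
- move=> [[e|[[[]|[]]|]]|] //=; apply/codomP.
  + by exists (Some (inl e)).
  + by exists None.
  + by case=> -[[]|].
- case=> [[e|[]]|] //=.
    by rewrite -!imset_comp.
  by rewrite !(imsetU, imset_set1) cu.
Qed.

(** The pendant path [u - v - w] seen in two ways, with bridge [vw] on the left and [uv] on the
    right, so that [invariant_link] applies at either edge. *)
Lemma link_assoc (G : mgraph) (u : vert G) :
  miso (link (G1 := link (G2 := K1 0) u tt) (G2 := K1 0) (inr tt) tt)
       (link (G2 := K2) u (inl tt)).
Proof.
pose P := link (G1 := link (G2 := K1 0) u tt) (G2 := K1 0) (inr tt) tt.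
pose Q := link (G2 := K2) u (inl tt).
pose hv (x : vert P) : vert Q :=
  match x with inl (inl x) => inl x | inl (inr _) => inr (inl tt) | inr _ => inr (inr tt) end.
pose he (e : edge P) : edge Q :=
  match e with
  | Some (inl (Some (inl e))) => Some (inl e)
  | Some (inl None) => None
  | _ => Some (inr None)
  end.
apply: (@misoI P Q hv he).
- by move=> [[x|[]]|[]] [[y|[]]|[]] //= [->].
- move=> [x|[[]|[]]]; first by exists (inl (inl x)).
    by exists (inl (inr tt)).
  by exists (inr tt).
- by move=> [[[[x|[]]|]|[]]|] // [[[[y|[]]|]|[]]|] //= [->].
- move=> [[e|[[[]|[]]|]]|] //=.
  + by exists (Some (inl (Some (inl e)))).
  + by exists None.
  + by exists (Some (inl None)).
- case=> [[[[e|[]]|]|[]]|] //=.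
  + by rewrite -!imset_comp.
  + by rewrite !(imsetU, imset_set1).
  + by rewrite !(imsetU, imset_set1).
Qed.

(** * The identity forced on an invariant satisfying the rules *)

Section Necessity.
Variables (R : comNzRingType) (a b c d : R) (f : nat -> R) (F : mgraph -> R).
Hypotheses (Fiso : graph_invariant F) (Fedge : rule_edge a b c d F).
Hypotheses (Funion : rule_union F) (Fbase : rule_base f F).

Lemma invariant_no_vertex G : #|vert G| = 0%N -> F G = 1.
Proof. by move=> /empty_iso/Fiso<-; rewrite Fbase.2. Qed.

(** Extends rule (2) to empty factors, which arise when vertices are deleted. *)
Lemma invariant_munion G1 G2 : F (munion G1 G2) = F G1 * F G2.
Proof.
have [e1|n1] := posnP #|vert G1|.
  by rewrite -(Fiso (munion0l_iso G2 e1)) (invariant_no_vertex e1) mul1r.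
have [e2|n2] := posnP #|vert G2|.
  by rewrite -(Fiso (munion0r_iso G1 e2)) (invariant_no_vertex e2) mulr1.
exact: Funion.
Qed.

Lemma invariant_link G1 G2 (u : vert G1) (v : vert G2) :
  F (link u v) = a * (F G1 * F G2) + b * F (@contract (link u v) None)
    + c * (F (del_verts [set u]) * F G2) + c * (F G1 * F (del_verts [set v]))
    + d * (F (del_verts [set u]) * F (del_verts [set v])).
Proof.
rewrite (@Fedge (link u v) None (inl u) (inr v)) //.
(* The untouched side is written as a deletion of [set0], so that [link_del_verts] covers all three
   deletions. *)
have setl : [set inl u] = [set inl x | x in [set u]] :|: [set inr x | x in set0] :> {set vert G1 + vert G2}.
  by rewrite imset_set1 imset0 setU0.
have setr : [set inr v] = [set inl x | x in set0] :|: [set inr x | x in [set v]] :> {set vert G1 + vert G2}.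
  by rewrite imset_set1 imset0 set0U.
have setlr : [set inl u; inr v] = [set inl x | x in [set u]] :|: [set inr x | x in [set v]] :> {set vert G1 + vert G2}.
  by rewrite !imset_set1.
rewrite setlr {1}setl {1}setr -(Fiso (link_del_edge u v)).
rewrite -!(Fiso (link_del_verts _)) ?set11 ?orbT // !invariant_munion.
by rewrite -(Fiso (del_verts0_iso G1)) -(Fiso (del_verts0_iso G2)).
Qed.

Lemma invariant_path G (u : vert G) :
  (b * c + c ^+ 2 + d - a * d) * (F G - f 0 * F (del_verts [set u])) = 0.
Proof.
have k0 : F (K1 0) = f 0 by rewrite Fbase.1.
have K1del (A : {set vert (K1 0)}) : A = [set tt] -> F (del_verts A) = 1.
  move=> ->; apply: invariant_no_vertex; rewrite card_del_verts cardsC1 card_unit //.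
have P H w : F (link (G1 := H) (G2 := K1 0) w tt) = a * (F H * f 0) + b * F H
    + c * (F (del_verts [set w]) * f 0) + c * F H + d * F (del_verts [set w]).
  by rewrite invariant_link -(Fiso (link_K1_contract w)) (K1del [set tt]) // k0 !mulr1.
have delP H w : F (@del_verts (link (G1 := H) (G2 := K1 0) w tt) [set inr tt]) = F H.
  have setr : [set inr tt] = [set inl x | x in set0] :|: [set inr x | x in [set tt]]
      :> {set vert H + unit} by rewrite imset_set1 imset0 set0U.
  rewrite setr -(Fiso (@link_del_verts H (K1 0) w tt set0 [set tt] _)) ?set11 ?orbT //.
  by rewrite invariant_munion (K1del [set tt]) // mulr1 -(Fiso (del_verts0_iso H)).
have delK2 : F (@del_verts K2 [set inl tt]) = f 0.
  have setl : [set inl tt] = [set inl x | x in [set tt]] :|: [set inr x | x in set0]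
      :> {set unit + unit} by rewrite imset_set1 imset0 setU0.
  rewrite setl -(Fiso (@link_del_verts (K1 0) (K1 0) tt tt [set tt] set0 _)) ?set11 //.
  by rewrite invariant_munion (K1del [set tt]) // mul1r -(Fiso (del_verts0_iso (K1 0))).
(* The left side is expanded at [vw], the right side at [uv]. [P] evaluates the pendant edges that
   remain, [delP] and [delK2] the graphs left after deleting [v]; the difference of the two
   expansions is the claimed product. *)
have := Fiso (link_assoc u).
rewrite [in RHS]invariant_link -(Fiso (link_K2_contract u)) delK2 !P delP (K1del [set tt]) // k0.
move/eqP; rewrite -subr_eq0 => /eqP <-; ring.
Qed.

End Necessity.

(** In an integral domain the nonzero factor cancels from [invariant_path], so each vertex removed
    contributes [f 0], down to the vertexless graph with value 1. *)
Lemma well_defined_trivial (R : idomainType) (a b c d : R) (f : nat -> R) :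
  b * c + c ^+ 2 + d - a * d != 0 -> well_defined a b c d f -> trivial a b c d f.
Proof.
move=> q_neq0 [F [valF [Fiso Fedge Funion Fbase]]].
have FE G : F G = f 0 ^+ #|vert G|.
  move En : #|vert G| => n; elim: n G En => [|n IH] G En.
    by rewrite (invariant_no_vertex Fiso Fbase).
  have /card_gt0P[u _] : (0 < #|vert G|)%N by rewrite En.
  have /eqP := invariant_path Fiso Fedge Funion Fbase u.
  rewrite mulf_eq0 (negbTE q_neq0) subr_eq0 => /eqP->.
  by rewrite IH -?exprS // card_del_verts cardsC1 En.
by move=> G x k _ /valF-> /valF->; rewrite (FE (K1 0)) card_unit expr1 FE.
Qed.

Theorem theorem4 (R : idomainType) (a b c d : R) (f : nat -> R) :
  well_defined a b c d f <->
  (b * c + c ^+ 2 + d - a * d = 0 \/ trivial a b c d f).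
Proof.
split=> [wd|[q0|triv]].
- have [q0|q_neq0] := eqVneq (b * c + c ^+ 2 + d - a * d) 0; first by left.
  by right; apply: well_defined_trivial.
- exact: functional_well_defined (value_graph_value q0).
- exact: trivial_well_defined.
Qed.
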